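(* Let $f:\mathbb{R}^n\times\mathbb{R}^m\to\mathbb{R}$ be convex and $\lambda\in\mathbb{R}_+^n$. Let $(x^\star,y^\star,z^\star)$ be a globally optimal solution of $$\min_{x\in\mathbb{R}^n,\;y\in\mathbb{R}^m,\;z\in\{0,1\}^n}\; f(x,y)+\sum_{i=1}^n\lambda_i z_i\quad\text{s.t.}\quad x_i(1-z_i)=0,\; i=1,\dots,n.$$ Then, for every coordinate $i\in\{1,\dots,n\}$: $$z_i^\star=0\;\Longrightarrow\; x_i^\star=0\ \text{ and }\ V_i^{\mathrm{off}}(x_{-i}^\star,y^\star)\le V_i^{\mathrm{on}}(x_{-i}^\star,y^\star),$$ $$z_i^\star=1\;\Longrightarrow\; x_i^\star\in X_i^\star(x_{-i}^\star,y^\star)\ \text{ and }\ V_i^{\mathrm{on}}(x_{-i}^\star,y^\star)\le V_i^{\mathrm{off}}(x_{-i}^\star,y^\star).$$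
   Context: For $x\in\mathbb{R}^n$ and an index $i$, $x_{-i}$ denotes all coordinates of $x$ except $x_i$. For fixed $(x_{-i},y)$ set $f_i(\xi;x_{-i},y):=f(x_1,\dots,x_{i-1},\xi,x_{i+1},\dots,x_n,y)$. Define the off-regime value $V_i^{\mathrm{off}}(x_{-i},y):=f_i(0;x_{-i},y)$, the on-regime value $V_i^{\mathrm{on}}(x_{-i},y):=\inf_{\xi\in\mathbb{R}}f_i(\xi;x_{-i},y)+\lambda_i$, and the set of coordinate minimizers $X_i^\star(x_{-i},y):=\arg\min_{\xi\in\mathbb{R}}f_i(\xi;x_{-i},y)$ (empty if the infimum is not attained). *)

(* Defs.v *)
From mathcomp Require Import all_boot all_order all_algebra.
From mathcomp Require Import all_classical all_reals all_analysis.

Set Implicit Arguments.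
Unset Strict Implicit.
Unset Printing Implicit Defensive.

Import Order.TTheory GRing.Theory Num.Theory.

Local Open Scope classical_set_scope.
Local Open Scope ring_scope.

Section IndicatorProblem.
Context {R : realType} {n m : nat}.
Implicit Types (f : 'rV[R]_n * 'rV[R]_m -> R) (lam x : 'rV[R]_n)
  (y : 'rV[R]_m) (z : 'rV[bool]_n) (i : 'I_n) (xo : 'rV[R]_n.-1).

(** The binary vector [z] has boolean entries, read as 0 or 1 in [R] through
    the coercion [bool >-> nat] followed by [%:R]. *)
Definition objective f lam x y z : R :=
  f (x, y) + \sum_(i < n) lam 0 i * (z 0 i)%:R.

Definition feasible x z : Prop :=
  forall i, x 0 i * (1 - (z 0 i)%:R) = 0.

Definition globally_optimal f lam x y z : Prop :=
  feasible x z /\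
  forall x' y' z', feasible x' z' ->
    objective f lam x y z <= objective f lam x' y' z'.

(** The vector [x_{-i}] is [col' i x], of length [n.-1]; [insert_coord i xi xo]
    puts the scalar [xi] back in position [i]. *)
Definition insert_coord i (xi : R) xo : 'rV[R]_n :=
  \row_j (if unlift i j is Some k then xo 0 k else xi).

Lemma insert_coord_col' i x : insert_coord i (x 0 i) (col' i x) = x.
Proof. by apply/rowP => j; rewrite mxE; case: unliftP => [k|] -> //; rewrite mxE. Qed.

Definition coord_fun f i xo y (xi : R) : R := f (insert_coord i xi xo, y).

Definition V_off f i xo y : R := coord_fun f i xo y 0.

(** The infimum is taken in the extended reals since [coord_fun f i xo y] may be
    unbounded below, in which case [V_on] is [-oo]. *)
Definition V_on f lam i xo y : \bar R :=
  (ereal_inf (range (fun xi : R => (coord_fun f i xo y xi)%:E)) + (lam 0 i)%:E)%E.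

Definition coord_argmin f i xo y : set R :=
  [set xi | forall t : R, coord_fun f i xo y xi <= coord_fun f i xo y t].

End IndicatorProblem.

(* Main.v *)
Require Import Defs.
From mathcomp Require Import all_boot all_order all_algebra.
From mathcomp Require Import all_classical all_reals all_analysis.

Set Implicit Arguments.
Unset Strict Implicit.
Unset Printing Implicit Defensive.

Import Order.TTheory GRing.Theory Num.Theory.

Local Open Scope classical_set_scope.
Local Open Scope ring_scope.

(** Optimality of the triple is tested only against competitors that change the
    pair (x_i, z_i) and keep y and every other coordinate.  The penalty terms of the
    other coordinates cancel, so what remains is a one-dimensional problem in
    (xi, b), with the constraint xi (1 - b) = 0 and the cost f_i(xi) + lam_i b, which
    (x_i, z_i) solves ([optimal_coordinate]).  Its feasible pairs are (0, 0), whose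
    cost is the off-regime value, and (xi, 1) with xi arbitrary, whose costs have
    the on-regime value as infimum.
    - If z_i = 0, feasibility forces x_i = 0, and comparison with all pairs (xi, 1)
      bounds the on-regime value from below by the off-regime value.
    - If z_i = 1, comparison with the pairs (xi, 1) says that x_i minimizes f_i, so
      that the on-regime value is at most f_i(x_i) + lam_i, and comparison with
      (0, 0) bounds this by the off-regime value. *)

Lemma insert_coord_at (R : realType) (n : nat) (i : 'I_n) (xi : R)
    (xo : 'rV[R]_n.-1) : insert_coord i xi xo 0 i = xi.
Proof. by rewrite mxE unlift_none. Qed.

Lemma insert_coord_col'_neq (R : realType) (n : nat) (i j : 'I_n) (xi : R)
    (x : 'rV[R]_n) : j != i -> insert_coord i xi (col' i x) 0 j = x 0 j.
Proof.
by rewrite mxE; case: unliftP => [k ->|->]; rewrite ?mxE ?eqxx.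
Qed.

(** The competitor puts [xi] and [b] in position [i] of [x] and [z]; all other
    penalty terms occur on both sides of the global inequality and cancel. *)
Lemma optimal_coordinate (R : realType) (n m : nat)
    (f : 'rV[R]_n * 'rV[R]_m -> R) (lam x : 'rV[R]_n) (y : 'rV[R]_m)
    (z : 'rV[bool]_n) (i : 'I_n) (xi : R) (b : bool) :
  globally_optimal f lam x y z -> xi * (1 - b%:R) = 0 ->
  coord_fun f i (col' i x) y (x 0 i) + lam 0 i * (z 0 i)%:R <=
    coord_fun f i (col' i x) y xi + lam 0 i * b%:R.
Proof.
move=> [feas opt] xib.
pose z' : 'rV[bool]_n := \row_j (if j == i then b else z 0 j).
have feas' : feasible (insert_coord i xi (col' i x)) z'.
  move=> j; rewrite [z' 0 j]mxE; case: (eqVneq j i) => [->|ji].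
    by rewrite insert_coord_at.
  by rewrite insert_coord_col'_neq.
have := opt _ y _ feas'.
rewrite /objective /coord_fun insert_coord_col' (bigD1 i) //=.
rewrite [X in _ <= _ + X](bigD1 i) //= [z' 0 i]mxE eqxx !addrA.
rewrite [X in _ <= _ + X](eq_bigr (fun j => lam 0 j * (z 0 j)%:R)) ?lerD2r //.
by move=> j /negbTE ji; rewrite mxE ji.
Qed.

Theorem proposition1 (R : realType) (n m : nat)
    (f : 'rV[R]_n * 'rV[R]_m -> R) (lam : 'rV[R]_n)
    (f_convex : convex_function setT f)
    (lam_ge0 : forall i : 'I_n, 0 <= lam 0 i)
    (x : 'rV[R]_n) (y : 'rV[R]_m) (z : 'rV[bool]_n)
    (opt : globally_optimal f lam x y z) (i : 'I_n) :
  (z 0 i = false ->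
     x 0 i = 0 /\
     ((V_off f i (col' i x) y)%:E <= V_on f lam i (col' i x) y)%E) /\
  (z 0 i = true ->
     x 0 i \in coord_argmin f i (col' i x) y /\
     (V_on f lam i (col' i x) y <= (V_off f i (col' i x) y)%:E)%E).
Proof.
have coord_opt xi b := optimal_coordinate i (xi := xi) (b := b) opt.
split=> zi.
  have xi0 : x 0 i = 0 by have := opt.1 i; rewrite zi subr0 mulr1.
  split=> //; rewrite /V_on -leeBlDr //.
  apply: le_ereal_inf_tmp => _ [t _ <-].
  rewrite -EFinB lee_fin lerBlDr /V_off.
  have := coord_opt t true; rewrite zi xi0 mulr0 addr0 mulr1.
  by apply; rewrite subrr mulr0.
have xi_min : coord_argmin f i (col' i x) y (x 0 i).
  move=> t; have := coord_opt t true; rewrite zi lerD2r.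
  by apply; rewrite subrr mulr0.
split; first exact/mem_set.
apply: (@le_trans _ _ (coord_fun f i (col' i x) y (x 0 i) + lam 0 i)%:E).
  by rewrite EFinD /V_on leeD2r //; apply: ereal_inf_lbound; exists (x 0 i).
have := coord_opt 0 false; rewrite zi mulr1 mulr0 addr0 lee_fin.
by apply; rewrite mul0r.
Qed.
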